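(* Let $R_1$ and $R_2$ be (not necessarily finite) commutative local rings with identity, let $I_1\neq R_1$ be an ideal of $R_1$ and $I_2\neq R_2$ an ideal of $R_2$, and put $R=R_1\times R_2$, $I=I_1\times I_2$. If there exist vertices $x,y$ of $\Gamma''_{I_1}(R_1)$ that are adjacent in $\Gamma''_{I_1}(R_1)$, or there exist vertices $x,y$ of $\Gamma''_{I_2}(R_2)$ that are adjacent in $\Gamma''_{I_2}(R_2)$, then $\Gamma''_I(R)$ is not planar.
   Context: $R_1\times R_2$ has componentwise operations. For a commutative ring $S$ and an ideal $J$ of $S$, $\Gamma''_J(S)$ is the simple undirected graph whose vertex set is $\{x\in S\setminus J : xS+J\neq S\}$, and two distinct vertices $x,y$ are adjacent if and only if $x\notin yS+J$ and $y\notin xS+J$. A graph is planar if it can be drawn in the plane with edges meeting only at their endpoints. *)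

(* Defs.v *)
From HB Require Import structures.
From mathcomp Require Import all_boot all_order all_algebra.
From mathcomp Require Import all_classical all_reals all_analysis.
From mathcomp Require Import Rstruct Rstruct_topology.
From Stdlib Require Import Rdefinitions.
Set Implicit Arguments. Unset Strict Implicit. Unset Printing Implicit Defensive.
Import Order.TTheory GRing.Theory Num.Theory.
Local Open Scope ring_scope.

Definition ideal_p (S : comNzRingType) (J : S -> Prop) : Prop :=
  [/\ J 0, (forall a b, J a -> J b -> J (a + b)),
      (forall a, J a -> J (- a)) & (forall r a, J a -> J (r * a))].

Definition proper_ideal_p (S : comNzRingType) (J : S -> Prop) : Prop :=
  ideal_p J /\ exists x, ~ J x.

Definition maximal_ideal_p (S : comNzRingType) (M : S -> Prop) : Prop :=
  proper_ideal_p M /\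
  forall J : S -> Prop, ideal_p J -> (forall x, M x -> J x) ->
    (forall x, J x) \/ (forall x, J x <-> M x).

Definition local_ring_p (S : comNzRingType) : Prop :=
  exists M : S -> Prop, maximal_ideal_p M /\
    forall M' : S -> Prop, maximal_ideal_p M' -> forall x, M' x <-> M x.

Definition in_coset (S : comNzRingType) (J : S -> Prop) (x z : S) : Prop :=
  exists s j, J j /\ z = x * s + j.

Definition gvert (S : comNzRingType) (J : S -> Prop) (x : S) : Prop :=
  ~ J x /\ ~ (forall z, in_coset J x z).

Definition gadj (S : comNzRingType) (J : S -> Prop) (x y : S) : Prop :=
  [/\ gvert J x, gvert J y, x <> y, ~ in_coset J y x & ~ in_coset J x y].

Definition prod_ideal (S1 S2 : comNzRingType) (J1 : S1 -> Prop) (J2 : S2 -> Prop)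
  : (S1 * S2)%type -> Prop := fun p => J1 p.1 /\ J2 p.2.

Local Open Scope classical_set_scope.

(* A (possibly infinite) simple graph with vertex predicate V and symmetric
   edge relation E is planar if it can be drawn in the plane R^2: vertices
   go to distinct points, each edge to a simple arc (continuous injective
   image of [0,1]) joining its endpoints, whose interior avoids all vertex
   points and the interiors of all other edges. *)
Definition planar (T : Type) (V : T -> Prop) (E : T -> T -> Prop) : Prop :=
  exists (f : T -> (R * R)%type) (arc : T -> T -> R -> (R * R)%type),
    (forall x y, V x -> V y -> f x = f y -> x = y) /\
    forall x y, E x y ->
      {within `[0, 1], continuous (arc x y)} /\
          arc x y 0 = f x /\ arc x y 1 = f y /\
          {in `[0, 1] &, injective (arc x y)} /\
          (forall t w, t \in `]0, 1[ -> V w -> arc x y t <> f w) /\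
          (forall u v, E u v -> ~ ((u = x /\ v = y) \/ (u = y /\ v = x)) ->
             forall s t, s \in `]0, 1[ -> t \in `]0, 1[ -> arc x y s <> arc u v t).

(* Main.v *)
(* The product graph contains a K_{3,3}: if x and y are adjacent in the first
   factor, then 1, 1 + x, 1 + y are units modulo I1, so every (u, 0) with u
   among them is adjacent to every (w, 1) with w among 0, x, y.

   K_{3,3} is not planar for a parity reason.  Compactness lets one replace the
   arcs by inscribed polygonal paths that keep non-adjacent edges disjoint.  For
   points with distinct abscissas, the parity of the number of crossings of two
   segments pq and rs equals the number of endpoints of pq lying above rs plus
   the number of endpoints of rs lying below pq.  Along two paths this
   telescopes to their endpoints.  Summing over the 18 pairs of non-adjacent
   edges of K_{3,3}, the terms "vertex above path" all cancel, and what remains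
   depends only on the order of the abscissas of the vertices and is odd. *)
From Stdlib Require Import Rdefinitions.
Require Import Defs.
From mathcomp Require Import all_boot all_order all_algebra.
From mathcomp Require Import all_classical all_reals all_analysis.
From mathcomp Require Import Rstruct Rstruct_topology ring lra.
Set Implicit Arguments. Unset Strict Implicit. Unset Printing Implicit Defensive.
Import Order.TTheory GRing.Theory Num.Theory.
Import numFieldNormedType.Exports.
Local Open Scope ring_scope.

(** * Parity of crossings of segments and of polygonal paths *)

Section Crossing.
Variable R : realFieldType.
Implicit Types p q r s v : (R * R)%type.

Definition seg_disjoint p q r s : Prop := forall t u : R,
  0 <= t <= 1 -> 0 <= u <= 1 ->
  p.1 + t * (q.1 - p.1) = r.1 + u * (s.1 - r.1) ->
  p.2 + t * (q.2 - p.2) <> r.2 + u * (s.2 - r.2).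

(** The exclusive or ignores the orientation of the segment and telescopes along a path. *)
Definition between p r s : bool := (p.1 < r.1) (+) (p.1 < s.1).

(* The factor [s.1 - r.1] makes the sign independent of the orientation of
   the segment. *)
Definition over p r s : bool :=
  0 < (s.1 - r.1) * ((s.1 - r.1) * (p.2 - r.2) - (s.2 - r.2) * (p.1 - r.1)).

Definition above p r s : bool := between p r s && over p r s.

(** The witness [u] locates the point of the segment at the abscissa of [p]; the expression in
    [over] is the vertical gap there times [(s.1 - r.1) ^+ 2]. *)
Lemma between_param p r s :
  p.1 != r.1 -> p.1 != s.1 -> between p r s ->
  exists2 u, 0 <= u <= 1 & p.1 = r.1 + u * (s.1 - r.1) /\
    over p r s = (r.2 + u * (s.2 - r.2) < p.2).
Proof.
move=> pr ps b.
have rs : (s.1 - r.1) != 0.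
  by apply/eqP => /subr0_eq E; move: b; rewrite /between E addbb.
exists ((p.1 - r.1) / (s.1 - r.1)); last split.
- have [rs0|rs0|/eqP] := ltrgtP (s.1 - r.1) 0; last by rewrite (negbTE rs).
    rewrite ler_ndivlMr // ler_ndivrMr // mul0r mul1r.
    by move: b; rewrite /between; case: (ltP p.1 r.1); case: (ltP p.1 s.1) => // *;
      apply/andP; split; lra.
  rewrite ler_pdivlMr // ler_pdivrMr // mul0r mul1r.
  by move: b; rewrite /between; case: (ltP p.1 r.1); case: (ltP p.1 s.1) => // *;
      apply/andP; split; lra.
- by rewrite divfK // addrC subrK.
rewrite /over -[_ < p.2]subr_gt0.
have -> : (s.1 - r.1) * ((s.1 - r.1) * (p.2 - r.2) - (s.2 - r.2) * (p.1 - r.1)) =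
  (s.1 - r.1) ^+ 2 * (p.2 - (r.2 + (p.1 - r.1) / (s.1 - r.1) * (s.2 - r.2))).
  by field.
by rewrite pmulr_rgt0 // exprn_even_gt0.
Qed.

(** The vertical gap is affine in [(t, u)], and equality of abscissas persists on the line from
    [(t, u)] to [(t', u')], so a change of sign would give a common point. *)
Lemma seg_disjoint_order p q r s (t t' u u' : R) :
  seg_disjoint p q r s ->
  0 <= t <= 1 -> 0 <= t' <= 1 -> 0 <= u <= 1 -> 0 <= u' <= 1 ->
  p.1 + t * (q.1 - p.1) = r.1 + u * (s.1 - r.1) ->
  p.1 + t' * (q.1 - p.1) = r.1 + u' * (s.1 - r.1) ->
  r.2 + u * (s.2 - r.2) <= p.2 + t * (q.2 - p.2) ->
  r.2 + u' * (s.2 - r.2) < p.2 + t' * (q.2 - p.2).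
Proof.
move=> dis t01 t'01 u01 u'01 E E' h; rewrite ltNge; apply/negP => h'.
set d := p.2 + t * (q.2 - p.2) - (r.2 + u * (s.2 - r.2)).
set d' := r.2 + u' * (s.2 - r.2) - (p.2 + t' * (q.2 - p.2)).
have d0 : 0 <= d by rewrite subr_ge0.
have d'0 : 0 <= d' by rewrite subr_ge0.
have [D0|D0] := eqVneq (d + d') 0.
  by apply: (dis t u) => //; apply/eqP; rewrite -subr_eq0 -/d; apply/eqP; lra.
have D1 : 0 < d + d' by rewrite lt_def D0 addr_ge0.
(* The gap runs affinely from [d] to [- d'], hence vanishes at [c]. *)
pose c := d / (d + d').
have c0 : 0 <= c by rewrite divr_ge0 // ltW.
have c1 : c <= 1 by rewrite ler_pdivrMr // mul1r lerDl.
have conv (a b : R) : 0 <= a <= 1 -> 0 <= b <= 1 -> 0 <= a + c * (b - a) <= 1.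
  move=> a01 b01; nra.
apply: (dis _ _ (conv t t' t01 t'01) (conv u u' u01 u'01)).
  transitivity ((1 - c) * (p.1 + t * (q.1 - p.1)) + c * (p.1 + t' * (q.1 - p.1))).
    by ring.
  by rewrite E E'; ring.
apply/eqP; rewrite -subr_eq0.
have -> : p.2 + (t + c * (t' - t)) * (q.2 - p.2) -
   (r.2 + (u + c * (u' - u)) * (s.2 - r.2)) = d - c * (d + d').
  by rewrite /d /d'; ring.
by rewrite /c divfK // subrr.
Qed.

(** The same segment is on top at every shared abscissa, so all four terms carry the same factor
    [beta]. The four [between] cancel, being made of four pairs of opposite strict comparisons. *)
Lemma seg_disjoint_parity p q r s :
  p.1 != r.1 -> p.1 != s.1 -> q.1 != r.1 -> q.1 != s.1 ->
  seg_disjoint p q r s ->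
  above p r s (+) above q r s (+) (between r p q && ~~ over r p q)
    (+) (between s p q && ~~ over s p q) = false.
Proof.
move=> pr ps qr qs dis.
pose beta := `[< exists t u : R, [/\ 0 <= t <= 1, 0 <= u <= 1,
  p.1 + t * (q.1 - p.1) = r.1 + u * (s.1 - r.1) &
  r.2 + u * (s.2 - r.2) < p.2 + t * (q.2 - p.2)] >].
have betaE (t u : R) : 0 <= t <= 1 -> 0 <= u <= 1 ->
    p.1 + t * (q.1 - p.1) = r.1 + u * (s.1 - r.1) ->
    (r.2 + u * (s.2 - r.2) < p.2 + t * (q.2 - p.2)) = beta.
  move=> t01 u01 E; apply/idP/asboolP => [h|[t' [u' [t'01 u'01 E' h]]]].
    by exists t, u.
  by apply: (seg_disjoint_order dis t'01 t01 u'01 u01 E' E); exact: ltW.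
have betaE' (t u : R) : 0 <= t <= 1 -> 0 <= u <= 1 ->
    p.1 + t * (q.1 - p.1) = r.1 + u * (s.1 - r.1) ->
    ~~ (p.2 + t * (q.2 - p.2) < r.2 + u * (s.2 - r.2)) = beta.
  move=> t01 u01 E; rewrite -(betaE t u) // -leNgt le_eqVlt.
  by case: eqP => // e; case: (dis t u t01 u01 E).
have i0 : 0 <= (0 : R) <= 1 by rewrite lexx ler01.
have i1 : 0 <= (1 : R) <= 1 by rewrite lexx ler01.
have E1 : above p r s = between p r s && beta.
  rewrite /above; case b : between => //=.
  have [u u01 [e ->]] := between_param pr ps b.
  by rewrite -(betaE 0 u) ?mul0r ?addr0.
have E2 : above q r s = between q r s && beta.
  rewrite /above; case b : between => //=.
  have [u u01 [e ->]] := between_param qr qs b.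
  by rewrite -(betaE 1 u) ?mul1r ?[p.1 + _]addrC ?[p.2 + _]addrC ?subrK.
rewrite [p.1 == _]eq_sym in pr; rewrite [p.1 == _]eq_sym in ps.
rewrite [q.1 == _]eq_sym in qr; rewrite [q.1 == _]eq_sym in qs.
have E3 : between r p q && ~~ over r p q = between r p q && beta.
  case b : between => //=.
  have [t t01 [e ->]] := between_param pr qr b.
  by rewrite -(betaE' t 0) ?mul0r ?addr0.
have E4 : between s p q && ~~ over s p q = between s p q && beta.
  case b : between => //=.
  have [t t01 [e ->]] := between_param ps qs b.
  by rewrite -(betaE' t 1) ?mul1r ?[r.1 + _]addrC ?[r.2 + _]addrC ?subrK.
rewrite E1 E2 E3 E4 /between -!andb_addl.
move: pr ps qr qs.
by case: (ltrgtP r.1 p.1); case: (ltrgtP s.1 p.1); case: (ltrgtP r.1 q.1);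
   case: (ltrgtP s.1 q.1).
Qed.

(** For [v] in general position, the parity of the number of times the downward vertical ray from
    [v] meets the path. *)
Definition above_path (n : nat) v (e : nat -> R * R) : bool :=
  \big[addb/false]_(k < n) above v (e k) (e k.+1).

Lemma addb_telescope (n : nat) (f : nat -> bool) :
  \big[addb/false]_(k < n) (f k (+) f k.+1) = f 0%N (+) f n.
Proof.
elim: n => [|n IH]; first by rewrite big_ord0 addbb.
by rewrite big_ord_recr /= IH -addbA; congr addb; rewrite addKb.
Qed.

(* In the double sum of [seg_disjoint_parity], the terms "above" telescope
   along [e] and the terms "below" along [g]. *)
Lemma path_disjoint_parity (n : nat) (e g : nat -> R * R) :
  (forall k l, (k <= n)%N -> (l <= n)%N -> (e k).1 != (g l).1) ->
  (forall k l, (k < n)%N -> (l < n)%N ->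
     seg_disjoint (e k) (e k.+1) (g l) (g l.+1)) ->
  above_path n (e 0%N) g (+) above_path n (e n) g
  (+) above_path n (g 0%N) e (+) above_path n (g n) e
  (+) between (g 0%N) (e 0%N) (e n) (+) between (g n) (e 0%N) (e n) = false.
Proof.
move=> ne dis.
pose below v k := between v (e k) (e k.+1) && ~~ over v (e k) (e k.+1).
(* A segment spanning the abscissa of [v] is either under [v] or not, so [below] and [above] add up
   to [between], which telescopes. *)
have belowE v : \big[addb/false]_(k < n) below v k =
    above_path n v e (+) between v (e 0%N) (e n).
  rewrite /between -(addb_telescope n (fun k => v.1 < (e k).1)) -big_split /=.
  by apply: eq_bigr => k _; rewrite /below /above /between;
     case: over; do 2 case: (v.1 < _).
have tel (F : nat -> nat -> bool) :
   \big[addb/false]_(k < n) \big[addb/false]_(l < n) (F k l (+) F k.+1 l) =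
   \big[addb/false]_(l < n) F 0%N l (+) \big[addb/false]_(l < n) F n l.
  rewrite exchange_big -big_split /=; apply: eq_bigr => l _.
  exact: (addb_telescope n (F^~ l)).
have : \big[addb/false]_(k < n) \big[addb/false]_(l < n)
   (above (e k) (g l) (g l.+1) (+) above (e k.+1) (g l) (g l.+1) (+)
    (below (g l) k (+) below (g l.+1) k)) = false.
  rewrite big1 // => k _; rewrite big1 // => l _.
  rewrite addbA; apply: seg_disjoint_parity; try exact: dis;
  by apply: ne => //; apply: ltnW.
under eq_bigr do rewrite big_split /=.
rewrite big_split /= (tel (fun k l => above (e k) (g l) (g l.+1))).
rewrite exchange_big /= (tel (fun l k => below (g l) k)) !belowE.
rewrite -/(above_path n (e 0%N) g) -/(above_path n (e n) g).
by do 4 case: above_path; do 2 case: between.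
Qed.

End Crossing.

(** Each [i] carries a Boolean [B i]. The disjoint paths leaving [a i] and [a i'] force [B i] and
    [B i'] to differ, and three Booleans cannot be pairwise distinct. *)
Lemma K33_parity (R : realFieldType) (n : nat) (a b : 'I_3 -> R * R)
    (P : 'I_3 -> 'I_3 -> nat -> R * R) :
  (forall i j, P i j 0%N = a i) -> (forall i j, P i j n = b j) ->
  (forall j j', j != j' -> (b j).1 != (b j').1) ->
  (forall i j i' j' k l, i != i' -> j != j' -> (k <= n)%N -> (l <= n)%N ->
     (P i j k).1 != (P i' j' l).1) ->
  ~ (forall i j i' j' k l, i != i' -> j != j' -> (k < n)%N -> (l < n)%N ->
     seg_disjoint (P i j k) (P i j k.+1) (P i' j' l) (P i' j' l.+1)).
Proof.
move=> P0 Pn bne ne dis.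
have key i j i' j' : i != i' -> j != j' -> 
  above_path n (a i) (P i' j') (+) above_path n (b j) (P i' j')
  (+) above_path n (a i') (P i j) (+) above_path n (b j') (P i j)
  (+) ((a i').1 < (a i).1) (+) ((a i').1 < (b j).1)
  (+) ((b j').1 < (a i).1) (+) ((b j').1 < (b j).1) = false.
  move=> ii jj; have := @path_disjoint_parity R n (P i j) (P i' j')
    (fun k l => ne i j i' j' k l ii jj) (fun k l => dis i j i' j' k l ii jj).
  by rewrite !P0 !Pn /between -!addbA.
pose i0 : 'I_3 := @Ordinal 3 0 isT; pose i1 : 'I_3 := @Ordinal 3 1 isT.
pose i2 : 'I_3 := @Ordinal 3 2 isT.
(* Summing over all j != j' shows B i (+) B i' = true for the three pairs i, i'. *)
pose S (F : 'I_3 * 'I_3 -> bool) := \big[addb/false]_(y <- [:: (i0, i1); (i1, i0);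
  (i0, i2); (i2, i0); (i1, i2); (i2, i1)]) F y.
have SE F : S F = F (i0, i1) (+) F (i1, i0) (+) F (i0, i2) (+) F (i2, i0)
    (+) F (i1, i2) (+) F (i2, i1).
  by rewrite /S !big_cons big_nil addbF !addbA.
(* Each index occurs twice in each position of the list, so terms in a single index cancel. *)
have S1 f : S (fun y => f y.1) = false.
  by rewrite SE /=; case: (f i0); case: (f i1); case: (f i2).
have S2 f : S (fun y => f y.2) = false.
  by rewrite SE /=; case: (f i0); case: (f i1); case: (f i2).
(* Each of the three unordered pairs contributes exactly one [true]: this is the source of the odd
   parity. *)
have Sb : S (fun y => (b y.2).1 < (b y.1).1) = true.
  rewrite SE /=; move: (bne i0 i1 isT) (bne i0 i2 isT) (bne i1 i2 isT).
  by case: (ltrgtP (b i0).1 (b i1).1); case: (ltrgtP (b i0).1 (b i2).1);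
     case: (ltrgtP (b i1).1 (b i2).1).
pose B i := S (fun y => above_path n (b y.1) (P i y.2)).
have BE i : S (fun y => above_path n (b y.2) (P i y.1)) = B i.
  by rewrite /B !SE /=; do 6 case: above_path.
have BB i i' : i != i' -> B i' (+) B i = true.
  move=> ii.
  have : S (fun y => above_path n (a i) (P i' y.2) (+) above_path n (b y.1) (P i' y.2)
    (+) above_path n (a i') (P i y.1) (+) above_path n (b y.2) (P i y.1)
    (+) ((a i').1 < (a i).1) (+) ((a i').1 < (b y.1).1)
    (+) ((b y.2).1 < (a i).1) (+) ((b y.2).1 < (b y.1).1)) = false.
    rewrite /S big_seq big1 // => y; rewrite !inE => hy; apply: key => //.
    by move: hy; do ?[case/orP]; move=> /eqP ->.
  rewrite /S !big_split /= -!/(S _).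
  rewrite (S2 (fun j => above_path n (a i) (P i' j))).
  rewrite (S1 (fun j => above_path n (a i') (P i j))).
  rewrite (S1 (fun=> (a i').1 < (a i).1)) (S1 (fun j => (a i').1 < (b j).1)).
  rewrite (S2 (fun j => (b j).1 < (a i).1)) Sb BE -/(B i').
  by case: (B i'); case: (B i).
move: (BB i0 i1 isT) (BB i0 i2 isT) (BB i1 i2 isT).
by case: (B i0); case: (B i1); case: (B i2).
Qed.

(** * General position by a shear *)

Lemma poly_nonroot (F : numFieldType) (p : {poly F}) :
  p != 0 -> exists c, ~~ root p c.
Proof.
move=> p0; apply: contrapT => /forallNP allr.
(* Otherwise the first [size p] naturals would be distinct roots, more than the degree allows. *)
have := ltnn (size p); rewrite -{1}(size_iota 0 (size p)).
rewrite -(size_map (fun i => i%:R : F)).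
rewrite max_poly_roots //.
  by apply/allP => c _; apply/negPn/negP; exact: allr.
rewrite map_inj_uniq ?iota_uniq // => i j /eqP.
by rewrite eqr_nat => /eqP.
Qed.

Definition shear (F : numFieldType) (c : F) (p : F * F) : F * F :=
  (p.1 + c * p.2, p.2).

(** For two distinct points, the difference of sheared abscissas is a nonzero polynomial in [c]; any
    non-root of the finite product of these polynomials works. *)
Lemma shear_generic (F : numFieldType) (T : finType) (f : T -> F * F) :
  exists c, forall u v, f u <> f v -> (shear c (f u)).1 != (shear c (f v)).1.
Proof.
pose q (x : T * T) : {poly F} :=
  ((f x.1).1 - (f x.2).1)%:P + ((f x.1).2 - (f x.2).2) *: 'X.
have [c] : exists c, ~~ root (\prod_(x | f x.1 != f x.2) q x) c.
  apply: poly_nonroot; apply/prodf_neq0 => x; apply: contra => /eqP q0.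
  have /(congr1 (fun p : {poly F} => p`_0)) := q0.
  have /(congr1 (fun p : {poly F} => p`_1)) := q0.
  rewrite !coefE /= ?mulr0 ?mulr1 ?addr0 ?add0r => /subr0_eq e2 /subr0_eq e1.
  by rewrite [f x.1]surjective_pairing e1 e2 -surjective_pairing.
rewrite /root horner_prod => /prodf_neq0 h; exists c => u v /eqP uv.
have := h (u, v) uv; rewrite /q !hornerE /=; apply: contra => /eqP.
rewrite /shear /= => e; apply/eqP.
by rewrite -[RHS](subrr ((f v).1 + c * (f v).2)) -{1}e; ring.
Qed.

Lemma seg_disjoint_shear (F : realFieldType) (c : F) p q r s :
  seg_disjoint p q r s ->
  seg_disjoint (shear c p) (shear c q) (shear c r) (shear c s).
Proof.
rewrite /seg_disjoint /= => dis t u t01 u01 e1 e2; apply: (dis t u) => //.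
transitivity (p.1 + c * p.2 + t * (q.1 + c * q.2 - (p.1 + c * p.2))
   - c * (p.2 + t * (q.2 - p.2))); first by ring.
by rewrite e1 e2; ring.
Qed.

(** * Disjoint arcs have disjoint inscribed polygonal paths *)

Definition coord (F : Type) (b : bool) (z : F * F) : F := if b then z.1 else z.2.

Lemma seg_disjoint_halfplanes (F : realFieldType) (m : F) (b : bool)
    (p q r s : F * F) :
  coord b p < m -> coord b q < m -> m < coord b r -> m < coord b s ->
  seg_disjoint p q r s.
Proof.
set h := coord b => hp hq hr hs t u t01 u01 e1 e2.
have : h p + t * (h q - h p) = h r + u * (h s - h r).
  by rewrite /h /coord; case: b {h hp hq hr hs}.
have : h p + t * (h q - h p) < m.
  by move: (h p) (h q) hp hq => x y hp hq; have [?|?] := leP x y; nra.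
have : m < h r + u * (h s - h r).
  by move: (h r) (h s) hr hs => x y hr hs; have [?|?] := leP x y; nra.
by move=> l1 l2 e; move: (lt_trans l2 l1); rewrite e ltxx.
Qed.

Lemma seg_disjoint_sym (F : realFieldType) (p q r s : F * F) :
  seg_disjoint r s p q -> seg_disjoint p q r s.
Proof. by move=> dis t u t01 u01 e1 e2; apply: (dis u t). Qed.

Local Open Scope classical_set_scope.

Lemma arc_coord_near (F : realType) (al : F -> F * F) (b : bool) (t0 : F)
    (A : set F) :
  {within `[0, 1], continuous al} -> t0 \in `[0, 1] ->
  nbhs (coord b (al t0)) A ->
  exists2 d, 0 < d &
    forall t, t \in `[0, 1] -> `|t0 - t| < d -> A (coord b (al t)).
Proof.
move=> /subspace_continuousP cal t01 hA.
have : \forall t \near within `[0, 1] (nbhs t0), A (coord b (al t)).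
  have hc : continuous (@coord F b).
    by rewrite /coord; case: b {hA} => z; [exact: cvg_fst | exact: cvg_snd].
  have := cvg_comp _ _ (cal t0 _) (hc (al t0)).
  by rewrite inE in t01; move=> /(_ t01) /(_ A hA).
rewrite /within /= => /nbhs_ballP [d /= d0 hd].
by exists d => // t tin dt; apply: (hd t) => //; rewrite inE in tin.
Qed.

(** Near each [(s, t)] one coordinate separates the two arcs, so short chords lie in opposite
    half-planes. Compactness of the parameter square makes the mesh uniform. *)
Lemma arcs_fine_disjoint (F : realType) (al be : F -> F * F) :
  {within `[0, 1], continuous al} -> {within `[0, 1], continuous be} ->
  (forall s t, s \in `[0, 1] -> t \in `[0, 1] -> al s <> be t) ->
  \forall n \near \oo, forall k l, (k < n.+1)%N -> (l < n.+1)%N ->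
    seg_disjoint (al (k%:R / n.+1%:R)) (al (k.+1%:R / n.+1%:R))
                 (be (l%:R / n.+1%:R)) (be (l.+1%:R / n.+1%:R)).
Proof.
pose I := `[0 : F, 1].
pose fine (al be : F -> F * F) (n : nat) (z : F * F) :=
  forall s t, s \in I -> t \in I -> `|z.1 - s| <= n.+1%:R^-1 ->
    `|z.2 - t| <= n.+1%:R^-1 -> seg_disjoint (al z.1) (al s) (be z.2) (be t).
have half (b : bool) (h := coord b) (al' be' : F -> F * F) (z : F * F) :
    {within `[0, 1], continuous al'} -> {within `[0, 1], continuous be'} ->
    z.1 \in I -> z.2 \in I -> h (al' z.1) < h (be' z.2) ->
    \forall z' \near z & n \near \oo, (I `*` I) z' -> fine al' be' n z'.
  move=> ca cb z1 z2 hab.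
  pose m := (h (al' z.1) + h (be' z.2)) / 2.
  have [d d0 hd] : exists2 d, 0 < d &
      forall t, t \in I -> `|z.1 - t| < d -> h (al' t) < m.
    apply: (arc_coord_near (A := [set x | x < m])) => //.
    by apply: lt_nbhsl; exact: (midf_lt hab).1.
  have [e e0 he] : exists2 e, 0 < e &
      forall t, t \in I -> `|z.2 - t| < e -> m < h (be' t).
    apply: (arc_coord_near (A := [set x | m < x])) => //.
    by apply: lt_nbhsr; exact: (midf_lt hab).2.
  (* One [r] is spent on moving the base point and one on the mesh, and together they stay within
     [d] and [e]. *)
  pose r := Num.min d e / 2.
  have r0 : 0 < r by rewrite divr_gt0 // lt_min d0.
  have rd : r + r <= d by rewrite -splitr ge_min lexx.
  have re : r + r <= e by rewrite -splitr ge_min lexx orbT.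
  exists (ball z r, [set n | n.+1%:R^-1 < r]) => /=.
    split; first exact: nbhsx_ballx.
    exact: (near_infty_natSinv_lt (PosNum r0)).
  move=> [z' n] /= [[/= b1 b2] nr] [/= i1 i2] s t sI tI.
  move=> /le_lt_trans /(_ nr) zs /le_lt_trans /(_ nr) zt.
  rewrite /ball /= in b1 b2.
  apply: (seg_disjoint_halfplanes (m := m) (b := b)); rewrite -/h.
  - by apply: hd; [rewrite inE | lra].
  - apply: hd => //; rewrite -(subrKA z'.1); apply: le_lt_trans (ler_normD _ _) _.
    exact: lt_le_trans (ltrD b1 zs) rd.
  - by apply: he; [rewrite inE | lra].
  - apply: he => //; rewrite -(subrKA z'.2); apply: le_lt_trans (ler_normD _ _) _.
    exact: lt_le_trans (ltrD b2 zt) re.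
move=> ca cb ab.
have cI : compact (I `*` I) by apply: compact_setX; exact: segment_compact.
have : \forall n \near \oo, I `*` I `<=` fine al be n.
  move/compact_near_coveringP/near_covering_withinP : cI; apply=> -[s t] [/= sI tI].
  have sI' : s \in I by rewrite inE.
  have tI' : t \in I by rewrite inE.
  (* The opposite order of the coordinates reduces to [half] by exchanging the arcs, and with them
     the two parameters. *)
  have swap (b : bool) : coord b (be t) < coord b (al s) ->
      \forall z' \near (s, t) & n \near \oo, (I `*` I) z' -> fine al be n z'.
    move=> hab; have [[U V] /= [nU nV] UV] := half b be al (t, s) cb ca tI' sI' hab.
    exists ([set z | U (z.2, z.1)], V) => /=.
      split=> //; have /= := @swap_continuous _ _ (s, t) U; apply.
      exact: nU.
    move=> [z' n] /= [Uz Vn] [z1 z2] s' t' s'I t'I zs zt.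
    apply: seg_disjoint_sym.
    exact: (UV ((z'.2, z'.1), n) (conj Uz Vn) (conj z2 z1)).
  have := ab s t sI' tI'.
  case: (ltrgtP (al s).1 (be t).1) => [h|h|h1] ne.
  - exact: (half true al be (s, t)).
  - exact: (swap true).
  case: (ltrgtP (al s).2 (be t).2) => [h|h|h2].
  - exact: (half false al be (s, t)).
  - exact: (swap false).
  by case: ne; rewrite [al s]surjective_pairing h1 h2 -surjective_pairing.
apply: filterS => n fin k l kn ln.
have n0 : 0 < n.+1%:R :> F by rewrite ltr0n.
have frac (i : nat) : (i <= n.+1)%N -> I (i%:R / n.+1%:R).
  move=> iN; rewrite /I /= in_itv /= divr_ge0 //= ler_pdivrMr // mul1r ler_nat //.
have step (i : nat) : `|i%:R / n.+1%:R - i.+1%:R / n.+1%:R| <= n.+1%:R^-1 :> F.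
  by rewrite -mulrBl -natr1 opprD addNKr mulN1r normrN ger0_norm // invr_ge0 ltW.
apply: (fin (k%:R / n.+1%:R, l%:R / n.+1%:R)) => //=; rewrite ?inE; try exact: frac.
by split; apply: frac; apply: ltnW.
Qed.

(** The arcs are replaced by polygonal paths with a common mesh, a shear puts the division points in
    general position, and [K33_parity] gives the contradiction. *)
Lemma K33_not_planar (T : Type) (V : T -> Prop) (E : T -> T -> Prop)
    (a b : 'I_3 -> T) :
  injective a -> injective b ->
  (forall i j, E (a i) (b j)) -> (forall i j, a i <> b j) ->
  (forall i, V (a i)) -> (forall j, V (b j)) -> ~ planar V E.
Proof.
move=> ainj binj Eab ab Va Vb [f [arc [finj drawing]]].
pose al (x : 'I_3 * 'I_3) := arc (a x.1) (b x.2).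
have cont x : {within `[0, 1], continuous (al x)}.
  by have [] := drawing _ _ (Eab x.1 x.2).
have al0 x : al x 0 = f (a x.1) by have [_ []] := drawing _ _ (Eab x.1 x.2).
have al1 x : al x 1 = f (b x.2) by have [_ [_ []]] := drawing _ _ (Eab x.1 x.2).
have alV x t w : 0 < t < 1 -> V w -> al x t <> f w.
  have [_ [_ [_ [_ [+ _]]]]] := drawing _ _ (Eab x.1 x.2).
  by move=> h t01; apply: h; rewrite inE /= in_itv.
have split01 (t : R) : t \in `[0, 1] -> [\/ t = 0, t = 1 | 0 < t < 1].
  rewrite inE /= in_itv /= => /andP[].
  rewrite le_eqVlt => /orP[/eqP <- _|t0]; first by constructor 1.
  by rewrite le_eqVlt => /orP[/eqP ->|t1]; [constructor 2 | constructor 3; rewrite t0].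
(* The drawing only speaks of open arcs; the end points are treated separately, using that [f] is
   injective on vertices. *)
have dis x y : x.1 != y.1 -> x.2 != y.2 ->
    forall s t, s \in `[0, 1] -> t \in `[0, 1] -> al x s <> al y t.
  move=> /eqP n1 /eqP n2 s t /split01[->|->|s01] /split01[->|->|t01];
    rewrite ?al0 ?al1.
  - by move=> /(finj _ _ (Va _) (Va _)) /ainj.
  - by move=> /(finj _ _ (Va _) (Vb _)) /ab.
  - by move=> /esym; apply: alV.
  - by move=> /(finj _ _ (Vb _) (Va _)) /esym /ab.
  - by move=> /(finj _ _ (Vb _) (Vb _)) /binj.
  - by move=> /esym; apply: alV.
  - exact: alV.
  - exact: alV.
  have [_ [_ [_ [_ [_ h]]]]] := drawing _ _ (Eab x.1 x.2).
  apply: (h _ _ (Eab y.1 y.2)); rewrite ?inE /= ?in_itv //.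
  by move=> [[/ainj /esym]|[/ab]].
(* Keeping the two inequalities inside [fine] lets [x] range over a finite type, so that one [n]
   serves all pairs of edges. *)
pose fine (x : ('I_3 * 'I_3) * ('I_3 * 'I_3)) (n : nat) : Prop :=
  x.1.1 != x.2.1 -> x.1.2 != x.2.2 ->
  forall k l, (k < n.+1)%N -> (l < n.+1)%N ->
  seg_disjoint (al x.1 (k%:R / n.+1%:R)) (al x.1 (k.+1%:R / n.+1%:R))
               (al x.2 (l%:R / n.+1%:R)) (al x.2 (l.+1%:R / n.+1%:R)).
have /filter_ex [n nP] : \forall n \near \oo, forall x, fine x n.
  apply: filter_forall => x.
  apply: filter_imply => x1; apply: filter_imply => x2.
  by apply: arcs_fine_disjoint; [exact: cont | exact: cont | exact: dis].
(* A path of [n.+1] segments has [n.+2] division points. *)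
have [c cP] := shear_generic (fun x : ('I_3 * 'I_3) * 'I_n.+2 => al x.1 (x.2%:R / n.+1%:R)).
have n0 : n.+1%:R != 0 :> R by rewrite pnatr_eq0.
have frac (i : nat) : (i <= n.+1)%N -> (i%:R / n.+1%:R : R) \in `[0, 1].
  by move=> iN; rewrite inE /= in_itv /= divr_ge0 //= ler_pdivrMr ?ltr0n // mul1r ler_nat.
have := @K33_parity _ n.+1 (fun i => shear c (f (a i))) (fun j => shear c (f (b j)))
  (fun i j k => shear c (al (i, j) (k%:R / n.+1%:R))).
apply.
- by move=> i j; rewrite mul0r al0.
- by move=> i j; rewrite divff // al1.
(* The index [ord_max] is the parameter 1, where the arc reaches [b j]; the choice of [ord0] as
   starting vertex is arbitrary. *)
- move=> j j' jj; have := cP ((ord0, j), ord_max) ((ord0, j'), ord_max).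
  rewrite /= divff // !al1; apply.
  by move=> /(finj _ _ (Vb _) (Vb _)) /binj /= e; move: jj; rewrite e eqxx.
- move=> i j i' j' k l ii jj kn ln.
  have := cP ((i, j), @Ordinal n.+2 k kn) ((i', j'), @Ordinal n.+2 l ln); apply => /=.
  by apply: dis => //; apply: frac.
- move=> i j i' j' k l ii jj kn ln; apply: seg_disjoint_shear.
  exact: (nP ((i, j), (i', j'))).
Qed.

(** * Maximal ideals, and units modulo an ideal of a local ring *)

Section Ideals.
Variable S : comNzRingType.
Implicit Types (J M : S -> Prop) (x y z : S).

Lemma proper_ideal1 J : proper_ideal_p J -> ~ J 1.
Proof. by case=> -[_ _ _ JM] [x Jx] J1; apply: Jx; rewrite -[x]mulr1; apply: JM. Qed.

Lemma coset_ideal J x : ideal_p J -> ideal_p (in_coset J x).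
Proof.
case=> J0 JD JN JM; split.
- by exists 0, 0; rewrite mulr0 addr0.
- move=> _ _ [s [j [Jj ->]]] [s' [j' [Jj' ->]]].
  by exists (s + s'), (j + j'); split; [apply: JD | ring].
- by move=> _ [s [j [Jj ->]]]; exists (- s), (- j); split; [apply: JN | ring].
- by move=> r _ [s [j [Jj ->]]]; exists (r * s), (r * j); split; [apply: JM | ring].
Qed.

(** Krull's theorem, by Zorn's lemma on sets whose union with [J] is an ideal avoiding 1. *)
Lemma exists_maximal_ideal J : proper_ideal_p J ->
  exists2 M, maximal_ideal_p M & forall x, J x -> M x.
Proof.
move=> pJ; have [idJ _] := pJ.
(* The union with J accounts for the empty chain, whose union is empty. *)
pose Q (A : set S) := [/\ ideal_p (fun x => A x \/ J x) & ~ (A 1 \/ J 1)].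
have [|A [[idA A1] maxA]] := @Zorn_bigcup S Q.
  move=> F FQ totF.
  have [J0 JD JN JM] := idJ.
  have lift X x : F X -> X x \/ J x -> (\bigcup_(Y in F) Y)%classic x \/ J x.
    by move=> FX [Xx|]; [left; exists X | right].
  split; last first.
    move=> [[X FX X1]|J1]; last exact: proper_ideal1 J1.
    by have [_] := FQ _ FX; apply; left.
  split; first by right.
  - move=> x y [[X FX Xx]|Jx] [[Y FY Yy]|Jy].
    + have [Z [FZ Zx Zy]] : exists Z, [/\ F Z, Z x & Z y].
        by have [XY|YX] := totF _ _ FX FY; [exists Y | exists X]; split; auto.
      have [[_ ZD _ _] _] := FQ _ FZ.
      by apply: (lift Z) => //; apply: ZD; left.
    + have [[_ ZD _ _] _] := FQ _ FX.
      by apply: (lift X) => //; apply: ZD; [left | right].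
    + have [[_ ZD _ _] _] := FQ _ FY.
      by apply: (lift Y) => //; apply: ZD; [right | left].
    + by right; apply: JD.
  - move=> x [[X FX Xx]|Jx]; last by right; apply: JN.
    have [[_ _ ZN _] _] := FQ _ FX.
    by apply: (lift X) => //; apply: ZN; left.
  - move=> r x [[X FX Xx]|Jx]; last by right; apply: JM.
    have [[_ _ _ ZM] _] := FQ _ FX.
    by apply: (lift X) => //; apply: ZM; left.
exists (fun x => A x \/ J x); last by right.
split; first by split=> //; exists 1.
move=> K idK AK; have [K1|K1] := pselect (K 1).
  by left=> x; have [_ _ _ KM] := idK; rewrite -[x]mulr1; apply: KM.
right=> x; split=> [Kx|]; last exact: AK.
apply: contrapT => nAx.
have KJ : (fun x => K x \/ J x) = K.
  by apply/funext => z; apply/propext; split=> [[//|Jz]|]; [apply: AK; right | left].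
apply: (maxA K); last by split; rewrite ?KJ //; case=> // J1; apply: K1; apply: AK; right.
split=> [z Az|KA]; first by apply: AK; left.
by apply: nAx; left; apply: KA.
Qed.

(* Both x and y lie in the unique maximal ideal M, which contains J. *)
Lemma local_unit_notin_coset J M x y :
  maximal_ideal_p M -> (forall M', maximal_ideal_p M' -> forall z, M' z <-> M z) ->
  ideal_p J -> ~ (forall z, in_coset J x z) -> ~ (forall z, in_coset J y z) ->
  ~ in_coset J y (1 + x).
Proof.
move=> maxM uniM idJ px py.
have sub z w : ~ (forall v, in_coset J z v) -> in_coset J z w -> M w.
  move=> pz zw; have [M' maxM' sM'] : exists2 M', maximal_ideal_p M' &
      forall v, in_coset J z v -> M' v.
    by apply: exists_maximal_ideal; split; [exact: coset_ideal | exact/existsNP].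
  by apply/(uniM M') => //; apply: sM'.
have Mx : M x by apply: (sub x) => //; exists 1, 0; rewrite mulr1 addr0; case: idJ.
move=> /(sub y _ py) M1x.
have [pM _] := maxM; apply: (proper_ideal1 pM).
have [[_ MD MN _] _] := pM.
by rewrite -[1](addrK x); apply: MD => //; apply: MN.
Qed.

Lemma local_adjacent_triples J x y : local_ring_p S -> proper_ideal_p J ->
  gadj J x y -> exists u w : 'I_3 -> S, [/\ injective u, injective w &
    forall i j, ~ in_coset J (w j) (u i)].
Proof.
move=> [M [maxM uniM]] pJ [[Jx px] [Jy py] xy _ _].
have [idJ _] := pJ; have [J0 _ _ _] := idJ.
(* Although 0 is not a vertex of the factor, it is a non-unit modulo [J], which suffices for the
   second triple: in the product it is paired with the component 1. *)
have p0 : ~ (forall z, in_coset J 0 z).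
  move=> /(_ 1) [s [j [Jj e]]]; apply: (proper_ideal1 pJ).
  by rewrite e mul0r add0r.
have x0 : x <> 0 by move=> e; apply: Jx; rewrite e.
have y0 : y <> 0 by move=> e; apply: Jy; rewrite e.
pose w (i : 'I_3) := [:: 0; x; y]`_i.
have pw i : ~ (forall z, in_coset J (w i) z).
  by case: i => [[|[|[|m]]] im].
have winj : injective w.
  move=> [[|[|[|m]]] im] [[|[|[|m']]] im'] //; rewrite /w /= => e;
  first [exact/val_inj | by case: x0 | by case: y0 | by case: xy].
exists (fun i => 1 + w i), w; split=> // [i j /addrI /winj //|i j].
exact: (local_unit_notin_coset maxM uniM).
Qed.

End Ideals.

(** * Adjacency in the product ring *)

Section Product.
Variables (R1 R2 : comNzRingType) (I1 : R1 -> Prop) (I2 : R2 -> Prop).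
Hypotheses (pI1 : proper_ideal_p I1) (pI2 : proper_ideal_p I2).

(** One component refutes each membership: the first by [wu], the second because it would put 1 into
    [I2]. *)
Lemma prod_gadj_l (u w : R1) : ~ I1 u -> ~ in_coset I1 w u ->
  gadj (prod_ideal I1 I2) (u, 0) (w, 1).
Proof.
move=> Iu wu.
have I21 := proper_ideal1 pI2.
have n1 : ~ in_coset (prod_ideal I1 I2) (w, 1) (u, 0).
  by move=> [[s1 s2] [[j1 j2] [[/= J1 _] [e _]]]]; apply: wu; exists s1, j1.
have n2 : ~ in_coset (prod_ideal I1 I2) (u, 0) (w, 1).
  move=> [[s1 s2] [[j1 j2] [[/= _ J2] [_ e]]]]; apply: I21.
  by rewrite e mul0r add0r.
split=> //; last by move=> [_ /eqP]; rewrite eq_sym oner_eq0.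
(* Each failed membership also shows that the ideal generated modulo [prod_ideal I1 I2] is proper,
   as a vertex requires. *)
- by split=> [[]//|h]; apply: n2; apply: h.
- by split=> [[]//|h]; apply: n1; apply: h.
Qed.

Lemma prod_gadj_r (u w : R2) : ~ I2 u -> ~ in_coset I2 w u ->
  gadj (prod_ideal I1 I2) (0, u) (1, w).
Proof.
move=> Iu wu.
have I11 := proper_ideal1 pI1.
have n1 : ~ in_coset (prod_ideal I1 I2) (1, w) (0, u).
  by move=> [[s1 s2] [[j1 j2] [[/= _ J2] [_ e]]]]; apply: wu; exists s2, j2.
have n2 : ~ in_coset (prod_ideal I1 I2) (0, u) (1, w).
  move=> [[s1 s2] [[j1 j2] [[/= J1 _] [e _]]]]; apply: I11.
  by rewrite e mul0r add0r.
split=> //; last by move=> [/eqP]; rewrite eq_sym oner_eq0.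
- by split=> [[]//|h]; apply: n2; apply: h.
- by split=> [[]//|h]; apply: n1; apply: h.
Qed.

End Product.

Lemma coset_notin (S : comNzRingType) (J : S -> Prop) (u w : S) :
  ~ in_coset J w u -> ~ J u.
Proof. by move=> h Ju; apply: h; exists 0, u; rewrite mulr0 add0r. Qed.

Theorem theorem3p14 (R1 R2 : comNzRingType) (I1 : R1 -> Prop) (I2 : R2 -> Prop) :
  local_ring_p R1 -> local_ring_p R2 ->
  proper_ideal_p I1 -> proper_ideal_p I2 ->
  (exists x y, gadj I1 x y) \/ (exists x y, gadj I2 x y) ->
  ~ planar (gvert (prod_ideal I1 I2)) (gadj (prod_ideal I1 I2)).
Proof.
move=> loc1 loc2 pI1 pI2 [[x [y xy]]|[x [y xy]]].
  have [u [w [uinj winj uw]]] := local_adjacent_triples loc1 pI1 xy.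
  have adj i j : gadj (prod_ideal I1 I2) (u i, 0) (w j, 1).
    by apply: prod_gadj_l => //; exact: coset_notin (uw i j).
  apply: (@K33_not_planar _ _ _ (fun i => (u i, 0)) (fun j => (w j, 1))) => //.
  - by move=> i j [/uinj].
  - by move=> i j [/winj].
  - by move=> i j; have [] := adj i j.
  - by move=> i; have [] := adj i ord0.
  - by move=> j; have [] := adj ord0 j.
have [u [w [uinj winj uw]]] := local_adjacent_triples loc2 pI2 xy.
have adj i j : gadj (prod_ideal I1 I2) (0, u i) (1, w j).
  by apply: prod_gadj_r => //; exact: coset_notin (uw i j).
apply: (@K33_not_planar _ _ _ (fun i => (0, u i)) (fun j => (1, w j))) => //.
- by move=> i j [/uinj].
- by move=> i j [/winj].
- by move=> i j; have [] := adj i j.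
- by move=> i; have [] := adj i ord0.
- by move=> j; have [] := adj ord0 j.
Qed.
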